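(* Let $k$ be a field of characteristic zero and let $m\geq 2$ be an integer. Let $\mathcal{G}=(y_{u,v})_{1\leq u\leq m-1,\,1\leq v\leq m+1}$ and $\mathcal{H}=(x_{i+j-1})_{1\leq i\leq m-1,\,1\leq j\leq m+1}$ denote, respectively, the $(m-1)\times(m+1)$ generic matrix over $k$ and the generic Hankel matrix of the same size over $k$. Then the respective special fiber algebras of the ideals $I_{m-1}(\mathcal{G})\subset k[y_{u,v}]$ and $I_{m-1}(\mathcal{H})\subset k[x_1,\ldots,x_{2m-1}]$ of maximal minors are isomorphic as graded $k$-algebras.
   Context: The $y_{u,v}$ are independent variables over $k$, and so are $x_1,\ldots,x_{2m-1}$. $I_{m-1}(\mathcal{M})$ is the ideal generated by the $(m-1)\times(m-1)$ minors of $\mathcal{M}$. For a homogeneous ideal $I$ of a standard graded polynomial ring $S$ over $k$ with irrelevant ideal $\mathfrak{m}$, the special fiber algebra of $I$ is $\mathcal{R}_S(I)/\mathfrak{m}\mathcal{R}_S(I)$, where $\mathcal{R}_S(I)=\bigoplus_{n\geq 0}I^n$ is the Rees algebra. When $I$ is generated by forms of one degree it is isomorphic, up to grading normalization, to the $k$-subalgebra of $S$ generated by those forms. *)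

(* Defs.v *)
From HB Require Import structures.
From mathcomp Require Import all_boot all_order all_algebra.
From mathcomp Require Import generic_quotient ring_quotient boolp mpoly zify.

Set Implicit Arguments.
Unset Strict Implicit.
Unset Printing Implicit Defensive.

Import GRing.Theory.

Local Open Scope ring_scope.
Local Open Scope quotient_scope.

Section Ideals.
Variable R : comNzRingType.
Implicit Types (I J G : R -> Prop).

Definition ideal_gen G : R -> Prop := fun x =>
  exists2 s : seq (R * R), (forall c, c \in s -> G c.2)
                         & x = \sum_(c <- s) c.1 * c.2.

Definition ideal_mul I J : R -> Prop :=
  ideal_gen (fun x => exists a b, [/\ I a, J b & x = a * b]).

Fixpoint ideal_exp I (n : nat) : R -> Prop :=
  if n is n'.+1 then ideal_mul I (ideal_exp I n') else fun=> True.

Lemma ideal_gen0 G : ideal_gen G 0.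
Proof. by exists [::]; rewrite ?big_nil. Qed.

Lemma ideal_genD G x y : ideal_gen G x -> ideal_gen G y -> ideal_gen G (x + y).
Proof.
move=> [s Gs ->] [t Gt ->]; exists (s ++ t); last by rewrite big_cat.
by move=> c; rewrite mem_cat => /orP[/Gs|/Gt].
Qed.

Lemma ideal_genMl G a x : ideal_gen G x -> ideal_gen G (a * x).
Proof.
move=> [s Gs ->]; exists [seq (a * c.1, c.2) | c <- s].
  by move=> _ /mapP[c /Gs Gc ->].
by rewrite big_map mulr_sumr; apply: eq_bigr => c _; rewrite mulrA.
Qed.

Lemma ideal_gen_id G x : G x -> ideal_gen G x.
Proof.
move=> Gx; exists [:: (1, x)]; last by rewrite big_seq1 mul1r.
by move=> c; rewrite inE => /eqP ->.
Qed.

Lemma ideal_gen_ind G (P : R -> Prop) :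
    P 0 -> (forall x y, P x -> P y -> P (x + y)) ->
    (forall a x, G x -> P (a * x)) -> forall x, ideal_gen G x -> P x.
Proof.
move=> P0 PD PM x [s Gs ->]; rewrite big_seq.
by elim/big_ind: _ => // c /Gs; apply: PM.
Qed.

Lemma ideal_exp0 I n : ideal_exp I n 0.
Proof. by case: n => //= n; apply: ideal_gen0. Qed.

Lemma ideal_expD I n x y :
  ideal_exp I n x -> ideal_exp I n y -> ideal_exp I n (x + y).
Proof. by case: n => //= n; apply: ideal_genD. Qed.

Lemma ideal_expMl I n a x : ideal_exp I n x -> ideal_exp I n (a * x).
Proof. by case: n => //= n; apply: ideal_genMl. Qed.

Lemma ideal_expM I p q x y :
  ideal_exp I p x -> ideal_exp I q y -> ideal_exp I (p + q) (x * y).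
Proof.
elim: p x => [|p IHp] x /= Ix Iy; first exact: ideal_expMl.
elim/ideal_gen_ind: Ix => [|u v Iu Iv|a _ [u [v [Iu Iv ->]]]].
- by rewrite mul0r; apply: ideal_gen0.
- by rewrite mulrDl; apply: ideal_genD.
rewrite -!mulrA; apply/ideal_genMl/ideal_gen_id.
by exists u, (v * y); split=> //; apply: IHp.
Qed.

End Ideals.

(* The Rees algebra of I, as the subring of R[t] of the polynomials           *)
(* \sum_i a_i t^i with a_i in I^i.                                            *)
Section Rees.
Variables (R : comNzRingType) (I : R -> Prop).

Definition rees_pred : {pred {poly R}} :=
  fun p => `[< forall i, ideal_exp I i p`_i >].

Lemma rees_predP (p : {poly R}) :
  reflect (forall i, ideal_exp I i p`_i) (p \in rees_pred).
Proof. exact: asboolP. Qed.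

Lemma rees_polyC (a : R) : a%:P \in rees_pred.
Proof.
by apply/rees_predP => -[|i] //; rewrite coefC /=; apply: ideal_gen0.
Qed.

Fact rees_subring_closed : subring_closed rees_pred.
Proof.
split=> [|p q /rees_predP Ip /rees_predP Iq|p q /rees_predP Ip /rees_predP Iq].
- exact: rees_polyC.
- apply/rees_predP => i; rewrite coefB; apply: ideal_expD => //.
  by rewrite -mulN1r; apply: ideal_expMl.
apply/rees_predP => i; rewrite coefM.
elim/big_ind: _ => [|x y Ix Iy|j _]; first exact: ideal_exp0.
  exact: ideal_expD.
by have := ideal_expM (Ip j) (Iq (i - j)%N); rewrite subnKC // -ltnS.
Qed.

HB.instance Definition _ :=
  GRing.isSubringClosed.Build {poly R} rees_pred rees_subring_closed.

Record rees := Rees { rees_val :> {poly R}; _ : rees_val \in rees_pred }.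

HB.instance Definition _ := [isSub for rees_val].
HB.instance Definition _ := [Choice of rees by <:].
HB.instance Definition _ := [SubChoice_isSubComNzRing of rees by <:].

Definition rees_const (a : R) : rees := Rees (rees_polyC a).

Fact rees_const_is_zmod_morphism : zmod_morphism rees_const.
Proof. by move=> a b; apply: val_inj; rewrite /= polyCB. Qed.

Fact rees_const_is_monoid_morphism : monoid_morphism rees_const.
Proof. by split=> [|a b]; apply: val_inj; rewrite //= polyCM. Qed.

HB.instance Definition _ :=
  GRing.isZmodMorphism.Build R rees rees_const rees_const_is_zmod_morphism.
HB.instance Definition _ :=
  GRing.isMonoidMorphism.Build R rees rees_const rees_const_is_monoid_morphism.

End Rees.

Section SpecialFiber.
Variables (k : fieldType) (n : nat).

Definition irrelevant_ideal : {mpoly k[n]} -> Prop :=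
  ideal_gen (fun f => exists i : 'I_n, f = 'X_i).

Variable I : {mpoly k[n]} -> Prop.

(* The extension of the irrelevant ideal to the Rees algebra of I.            *)
Definition irrelevant_rees : {pred rees I} := fun r =>
  `[< ideal_gen
        (fun s : rees I => exists2 f, irrelevant_ideal f & s = rees_const I f)
        r >].

Fact irrelevant_rees_closed : idealr_closed irrelevant_rees.
Proof.
split=> [||a u v /asboolP Mu /asboolP Mv].
- exact/asboolP/ideal_gen0.
- pose ev (f : {mpoly k[n]}) := f.@[fun=> 0].
  have ev0 f : irrelevant_ideal f -> ev f = 0.
    rewrite /ev; elim/ideal_gen_ind => [|x y ex ey|a _ [i ->]].
    + exact: meval0.
    + by rewrite mevalD ex ey addr0.
    + by rewrite mevalM mevalXU mulr0.
  apply/negP => /asboolP M1.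
  suff : ev (rees_val (1 : rees I))`_0 = 0.
    by rewrite /ev /= coef1 meval1 => /eqP; rewrite oner_eq0.
  elim/ideal_gen_ind: M1 => [|x y ex ey|a _ [f /ev0 ef ->]].
  + by rewrite /ev /= coef0 meval0.
  + by rewrite /ev /= coefD mevalD -/(ev _) ex -/(ev _) ey addr0.
  + by rewrite /ev /= coefMC mevalM -/(ev f) ef mulr0.
- by apply/asboolP/ideal_genD => //; apply: ideal_genMl.
Qed.

HB.instance Definition _ :=
  isIdealr.Build (rees I) irrelevant_rees irrelevant_rees_closed.

Definition special_fiber : Type := {ideal_quot irrelevant_rees}.

HB.instance Definition _ := GRing.ComNzRing.on special_fiber.

Definition fiber_pi (r : rees I) : special_fiber :=
  \pi_{ideal_quot irrelevant_rees} r.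

Fact fiber_pi_is_zmod_morphism : zmod_morphism fiber_pi.
Proof. exact: (rmorphB (\pi_{ideal_quot irrelevant_rees})). Qed.

Fact fiber_pi_is_monoid_morphism : monoid_morphism fiber_pi.
Proof.
split; first exact: (rmorph1 (\pi_{ideal_quot irrelevant_rees})).
exact: (rmorphM (\pi_{ideal_quot irrelevant_rees})).
Qed.

HB.instance Definition _ := GRing.isZmodMorphism.Build
  (rees I) special_fiber fiber_pi fiber_pi_is_zmod_morphism.
HB.instance Definition _ := GRing.isMonoidMorphism.Build
  (rees I) special_fiber fiber_pi fiber_pi_is_monoid_morphism.

Definition fiber_scale (c : k) (x : special_fiber) : special_fiber :=
  fiber_pi (rees_const I c%:MP) * x.

Fact fiber_scaleA a b x :
  fiber_scale a (fiber_scale b x) = fiber_scale (a * b) x.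
Proof. by rewrite /fiber_scale mulrA -!rmorphM. Qed.

Fact fiber_scale1 : left_id 1 fiber_scale.
Proof. by move=> x; rewrite /fiber_scale !rmorph1 mul1r. Qed.

Fact fiber_scaleDr : right_distributive fiber_scale +%R.
Proof. by move=> a x y; rewrite /fiber_scale mulrDr. Qed.

Fact fiber_scaleDl x : {morph fiber_scale^~ x : a b / a + b}.
Proof. by move=> a b; rewrite /fiber_scale !rmorphD mulrDl. Qed.

HB.instance Definition _ := GRing.Zmodule_isLmodule.Build k special_fiber
  fiber_scaleA fiber_scale1 fiber_scaleDr fiber_scaleDl.

Fact fiber_scaleAl (a : k) (x y : special_fiber) :
  a *: (x * y) = (a *: x) * y.
Proof. exact: mulrA. Qed.

HB.instance Definition _ :=
  GRing.Lmodule_isLalgebra.Build k special_fiber fiber_scaleAl.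

Fact fiber_scaleAr (a : k) (x y : special_fiber) :
  a *: (x * y) = x * (a *: y).
Proof. exact: mulrCA. Qed.

HB.instance Definition _ :=
  GRing.Lalgebra_isAlgebra.Build k special_fiber fiber_scaleAr.

(* The graded component of degree d, i.e., I^d / m I^d: the classes of the    *)
(* f t^d, where f is in I^d because f t^d is in the Rees algebra.             *)
Definition fiber_degree (d : nat) : special_fiber -> Prop := fun x =>
  exists2 r : rees I, (exists f, rees_val r = f *: 'X^d) & x = fiber_pi r.

End SpecialFiber.

Arguments fiber_degree {k n} I d x.

Definition graded_alg_isomorphic (k : fieldType) (A B : algType k)
    (degA : nat -> A -> Prop) (degB : nat -> B -> Prop) : Prop :=
  exists phi : {lrmorphism A -> B},
    bijective phi /\ forall d x, degA d x <-> degB d (phi x).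

Definition minors_ideal (R : comNzRingType) (p q : nat) (t : nat)
    (M : 'M[R]_(p, q)) : R -> Prop :=
  ideal_gen (fun x => exists (f : 'I_t -> 'I_p) (g : 'I_t -> 'I_q),
    [/\ {homo f : i j / (i < j)%N}, {homo g : i j / (i < j)%N}
      & x = \det (mxsub f g M)]).

Definition generic_mx (k : fieldType) (p q : nat) :
    'M[{mpoly k[p * q]}]_(p, q) :=
  \matrix_(u < p, v < q) 'X_(mxvec_index u v).

Fact hankel_subproof (p q : nat) (i : 'I_p) (j : 'I_q) :
  (i + j < (p + q).-1)%N.
Proof. by case: i j => [i ?] [j ?] /=; lia. Qed.

(* With indices counted from 0, the entry x_(i + j - 1) is 'X_(i + j).        *)
Definition hankel_mx (k : fieldType) (p q : nat) :
    'M[{mpoly k[(p + q).-1]}]_(p, q) :=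
  \matrix_(i < p, j < q) 'X_(Ordinal (hankel_subproof i j)).

(* Main.v *)
From HB Require Import structures.
Require Import Defs.
From mathcomp Require Import all_boot all_order all_algebra.
From mathcomp Require Import mpoly.
From mathcomp Require Import fingroup perm.
From mathcomp Require Import generic_quotient ring_quotient boolp zify.

(* When I is generated by forms F_1, ..., F_N of one degree, its special fiber
   algebra is k[T_1, ..., T_N] modulo the kernel of T_i |-> F_i t, so it suffices
   that the maximal minors of the generic p x (p + 2) matrix Y and of the Hankel
   matrix H satisfy the same relations. Relations among the minors of Y
   specialize to H. Conversely, the kernel of Y is spanned by two vectors, read
   as polynomials g_1, g_2 of degree at most p + 1. The 2 p linear conditions
   saying that H(x) kills g_1 and g_2 have 2 p + 1 unknowns, hence a solution x
   given by cofactors of a Sylvester matrix. Then H(x) has the same kernel as Y,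
   so H(x) = A Y up to a scalar and the minors of H(x) are proportional to those
   of Y. The factor is nonzero because it is so at Y = (0 | 1 | 0), where
   g_1 = 1, g_2 = t^(p+1) and H(x) is antidiagonal in its middle columns. *)

Set Implicit Arguments.
Unset Strict Implicit.
Unset Printing Implicit Defensive.

(** * Evaluation of polynomials and order of vanishing at the origin *)

Section MpolyAux.
Import GRing.Theory.
Local Open Scope ring_scope.

Lemma mmap_closed (n : nat) (R S : nzRingType) (f : R -> S) (h : 'I_n -> S)
    (P : S -> Prop) :
    P 0 -> P 1 -> (forall x y, P x -> P y -> P (x + y)) ->
    (forall x y, P x -> P y -> P (x * y)) ->
    (forall c, P (f c)) -> (forall i, P (h i)) ->
  forall p : {mpoly R[n]}, P (mmap f h p).
Proof.
move=> P0 P1 PD PM Pf Ph p; rewrite /mmap.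
apply: (big_ind P P0 PD) => m _; apply: (PM) => //; rewrite /mmap1.
apply: (big_ind P P1 PM) => i _.
by elim: (m i) => [|j Pj]; rewrite ?expr0 // exprS; apply: PM.
Qed.

Lemma rmorph_mmap (n : nat) (R S S' : nzRingType) (f : R -> S) (h : 'I_n -> S)
    (g : {rmorphism S -> S'}) (p : {mpoly R[n]}) :
  g (mmap f h p) = mmap (g \o f) (g \o h) p.
Proof.
rewrite /mmap rmorph_sum; apply: eq_bigr => m _.
rewrite rmorphM /mmap1 rmorph_prod; congr (_ * _).
by apply: eq_bigr => i _; rewrite rmorphXn.
Qed.

Lemma eq_mmap (n : nat) (R S : nzRingType) (f f' : R -> S) (h h' : 'I_n -> S)
    (p : {mpoly R[n]}) :
  f =1 f' -> h =1 h' -> mmap f h p = mmap f' h' p.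
Proof.
move=> ff' hh'; rewrite /mmap; apply: eq_bigr => m _.
by rewrite ff' (mmap1_eq _ hh').
Qed.

Variables (k : fieldType) (n : nat).
Implicit Types p q : {mpoly k[n]}.

(** Amounts to membership in the [d]-th power of the irrelevant ideal, but is read off the support;
    zero has every order. *)
Definition mpoly_order_ge (d : nat) p : Prop :=
  forall m, m \in msupp p -> (d <= mdeg m)%N.

Lemma mpoly_order_ge0 d : mpoly_order_ge d 0.
Proof. by move=> m; rewrite msupp0. Qed.

Lemma mpoly_order_geD d p q :
  mpoly_order_ge d p -> mpoly_order_ge d q -> mpoly_order_ge d (p + q).
Proof. by move=> op oq m /msuppD_le; rewrite mem_cat => /orP[/op|/oq]. Qed.

Lemma mpoly_order_geM d e p q :
  mpoly_order_ge d p -> mpoly_order_ge e q -> mpoly_order_ge (d + e) (p * q).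
Proof.
move=> op oq m /msuppM_le /allpairsP[[m1 m2] /= [/op m1P /oq m2P ->]].
by rewrite mdegD leq_add.
Qed.

Lemma mpoly_order_geMl d p q : mpoly_order_ge d q -> mpoly_order_ge d (p * q).
Proof. by move=> oq; rewrite -[d]add0n; apply: mpoly_order_geM. Qed.

Lemma dhomog_order_ge d p : p \is d.-homog -> mpoly_order_ge d p.
Proof. by move=> /dhomogP hp m /hp ->. Qed.

Lemma dhomog_order_gt d p : p \is d.-homog -> mpoly_order_ge d.+1 p -> p = 0.
Proof.
move=> /dhomogP hp op; apply/mpolyP => m; rewrite mcoeff0.
apply/eqP; rewrite mcoeff_eq0; apply/negP => mp.
by have := op _ mp; rewrite hp // ltnn.
Qed.

Lemma irrelevant_ideal_order p : irrelevant_ideal p -> mpoly_order_ge 1 p.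
Proof.
elim/ideal_gen_ind => [|x y|a _ [i ->]].
- exact: mpoly_order_ge0.
- exact: mpoly_order_geD.
- apply: mpoly_order_geMl; apply: dhomog_order_ge.
  by rewrite dhomogX; apply/eqP/mdeg1.
Qed.

(** Every monomial other than 1 is divisible by some variable. *)
Lemma irrelevant_ideal_sub_const p : irrelevant_ideal (p - (p@_0)%:MP).
Proof.
elim/mpolyind: p => [|c m p _ _ IHp].
  by rewrite mcoeff0 mpolyC0 subr0; apply: ideal_gen0.
rewrite mcoeffD mpolyCD opprD addrACA; apply: ideal_genD => //.
rewrite mcoeffZ mcoeffX; have [->|m0] := eqVneq m 0%MM.
  by rewrite mpolyX0 mulr1 -mul_mpolyC mulr1 subrr; apply: ideal_gen0.
rewrite mulr0 mpolyC0 subr0 -mul_mpolyC; apply: ideal_genMl.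
have [i mi] : exists i, (0 < m i)%N.
  apply/existsP; apply: contraNT m0; rewrite negb_exists => /forallP m0.
  by apply/eqP/mnmP => i; rewrite mnm0E; apply/eqP; rewrite -leqn0 leqNgt.
have /submK <- : (U_(i) <= m)%MM.
  by apply/mnm_lepP => j; rewrite mnm1E; case: eqP => // <-.
by rewrite mpolyXD; apply/ideal_genMl/ideal_gen_id; exists i.
Qed.

End MpolyAux.

(** * Presentation of the special fiber by the algebra of forms [F_i t] *)

Section Presentation.
Import GRing.Theory.
Local Open Scope ring_scope.
Local Open Scope quotient_scope.

Variables (k : fieldType) (n N e : nat) (G : {mpoly k[n]} -> Prop).
Variable F : 'I_N -> {mpoly k[n]}.
Hypothesis GF : forall x, G x <-> exists i, x = F i.
Hypothesis F_homog : forall i, F i \is e.-homog.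
Local Notation I := (ideal_gen G).

Lemma ideal_exp1 i : ideal_exp I 1 (F i).
Proof.
apply: ideal_gen_id; exists (F i), 1; rewrite mulr1; split=> //.
by apply/ideal_gen_id/GF; exists i.
Qed.

Fact rees_gen_subproof i : F i *: 'X \in rees_pred I.
Proof.
apply/rees_predP => -[|[|j]] //; rewrite coefZ coefX ?mulr1 ?mulr0.
- exact: ideal_exp1.
- exact: ideal_exp0.
Qed.

Definition rees_gen i : rees I := Rees (rees_gen_subproof i).

Definition rees_scalar : {rmorphism k -> rees I} := rees_const I \o @mpolyC n k.

Definition rees_eval : {rmorphism {mpoly k[N]} -> rees I} :=
  mmap rees_scalar rees_gen.

(** The map [T_i |-> F_i t] into the full polynomial ring in [t] rather than the Rees subring, so
    that kernels for different ideals can be compared. *)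
Definition form_eval : {mpoly k[N]} -> {poly {mpoly k[n]}} :=
  mmap (polyC \o @mpolyC n k) (fun i => F i *: 'X).

Lemma rees_evalC c : rees_eval c%:MP = rees_const I c%:MP.
Proof. exact: mmapC. Qed.

Lemma rees_evalXU i : rees_eval 'X_i = rees_gen i.
Proof. by rewrite /rees_eval /= mmapX mmap1U. Qed.

Lemma rees_evalE P : val (rees_eval P) = form_eval P.
Proof. by rewrite (rmorph_mmap _ _ val); apply: eq_mmap. Qed.


Lemma form_eval_homog P d : (form_eval P)`_d \is (e * d).-homog.
Proof.
move: d; pose Q (q : {poly {mpoly k[n]}}) := forall d, q`_d \is (e * d).-homog.
apply: (mmap_closed (P := Q)) => [d|d|x y Qx Qy d|x y Qx Qy d|c d|i d] /=.
- by rewrite coef0 dhomog0.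
- rewrite coef1; case: d => [|d]; last exact: dhomog0.
  by rewrite muln0 dhomog1.
- by rewrite coefD rpredD.
- rewrite coefM; apply: rpred_sum => j _.
  have -> : (e * d = e * j + e * (d - j))%N by rewrite -mulnDr subnKC // -ltnS.
  exact: dhomogM.
- rewrite coefC; case: d => [|d]; last exact: dhomog0.
  by rewrite muln0 -[c%:MP]mulr1 mul_mpolyC rpredZ // dhomog1.
- rewrite coefZ coefX; case: d => [|[|d]]; rewrite ?mulr0 ?dhomog0 //.
  by rewrite mulr1 muln1.
Qed.

Lemma form_eval_dhomog d P :
  P \is d.-homog -> exists f, form_eval P = f *: 'X^d.
Proof.
move=> /dhomogP hP; rewrite /form_eval /mmap big_seq.
elim/big_ind: _ => [|_ _ [f ->] [g ->]|m mP].
- by exists 0; rewrite scale0r.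
- by exists (f + g); rewrite scalerDl.
exists ((P@_m)%:MP * \prod_i F i ^+ m i).
rewrite -scalerA -mul_polyC; congr (_ * _).
have -> : d = mdeg m by rewrite -(hP m mP).
rewrite /mmap1 mdegE -prodrXr -scaler_prod.
by apply: eq_bigr => i _; rewrite exprZn.
Qed.

Lemma ideal_exp_order d x : ideal_exp I d x -> mpoly_order_ge (e * d) x.
Proof.
elim: d x => [|d IHd] x /=; first by rewrite muln0.
elim/ideal_gen_ind => [|u v|a _ [u [v [Iu Iv ->]]]].
- exact: mpoly_order_ge0.
- exact: mpoly_order_geD.
apply: mpoly_order_geMl; rewrite mulnS; apply: mpoly_order_geM; last exact: IHd.
elim/ideal_gen_ind: Iu => [|y z|b _ /GF[i ->]].
- exact: mpoly_order_ge0.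
- exact: mpoly_order_geD.
- exact/mpoly_order_geMl/dhomog_order_ge.
Qed.

(** Elements of [I^d] have order at least [e * d], and a factor from the irrelevant ideal adds one
    to the order without changing the degree in [t]. *)
Lemma irrelevant_rees_order (r : rees I) d :
  r \in @irrelevant_rees k n I -> mpoly_order_ge (e * d).+1 (val r)`_d.
Proof.
move=> /asboolP; elim/ideal_gen_ind => [|x y ox oy|a _ [f mf ->]] /=.
- by rewrite coef0; apply: mpoly_order_ge0.
- by rewrite coefD; apply: mpoly_order_geD.
rewrite coefMC -addn1; apply: mpoly_order_geM.
- by apply: ideal_exp_order; case: a => a /= /rees_predP.
- exact: irrelevant_ideal_order.
Qed.

Lemma fiber_pi_eq0 (r : rees I) :
  fiber_pi r = 0 <-> r \in @irrelevant_rees k n I.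
Proof.
rewrite -[r in r \in _]subr0 Quotient.idealrBE.
have -> : 0 = fiber_pi (0 : rees I) by rewrite rmorph0.
by split=> /eqP.
Qed.

(* P(F t) has t^d-coefficient of degree e d, while m I^d lives in degrees
   greater than e d. *)
Lemma fiber_pi_eval_eq0 P : fiber_pi (rees_eval P) = 0 <-> form_eval P = 0.
Proof.
rewrite -rees_evalE; split=> [/fiber_pi_eq0 rP|P0]; last first.
  by rewrite (_ : rees_eval P = 0) ?rmorph0 //; apply: val_inj.
apply/polyP => d; rewrite coef0; apply: (@dhomog_order_gt _ _ (e * d)).
- by rewrite rees_evalE form_eval_homog.
- exact: irrelevant_rees_order.
Qed.

(** The irrelevant ideal dies in the fiber, so the base ring acts through constant terms. *)
Lemma fiber_pi_const a :
  fiber_pi (rees_const I a) = fiber_pi (rees_const I (a@_0)%:MP).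
Proof.
apply/eqP; rewrite -subr_eq0 -!rmorphB; apply/eqP/fiber_pi_eq0/asboolP.
apply: ideal_gen_id; exists (a - (a@_0)%:MP) => //.
exact: irrelevant_ideal_sub_const.
Qed.

(** An element of [I^d] is a combination of [d]-fold products of the [F_i]; in the fiber its
    coefficients reduce to scalars, which leaves a form of degree [d] in the [T_i]. *)
Lemma fiber_pi_component d x : ideal_exp I d x ->
  exists2 r : rees I, val r = x *: 'X^d &
    exists2 P, P \is d.-homog & fiber_pi r = fiber_pi (rees_eval P).
Proof.
pose Q d x := exists2 r : rees I, val r = x *: 'X^d &
    exists2 P, P \is d.-homog & fiber_pi r = fiber_pi (rees_eval P).
have Q0 c : Q c 0.
  exists 0; first by rewrite scale0r.
  by exists 0; rewrite ?dhomog0 // !rmorph0.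
have QD c y z : Q c y -> Q c z -> Q c (y + z).
  move=> [r ry [P hP rP]] [s sz [P' hP' sP']].
  exists (r + s); first by rewrite rmorphD /= ry sz scalerDl.
  by exists (P + P'); rewrite ?rpredD // !rmorphD /= rP sP'.
have QC c a y : Q c y -> Q c (a * y).
  move=> [r ry [P hP rP]]; exists (rees_const I a * r).
    by rewrite rmorphM /= ry -scalerA -[RHS]mul_polyC.
  (* Only the constant term of [a] survives in the fiber. *)
  exists (a@_0 *: P); first by rewrite rpredZ.
  by rewrite -mul_mpolyC !rmorphM /= rees_evalC fiber_pi_const rP.
elim: d x => [|d IHd] x /=.
  move=> _; rewrite -[x]mulr1; apply: (QC); exists 1.
    by rewrite rmorph1 expr0 scale1r.
  by exists 1; rewrite ?dhomog1 // !rmorph1.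
elim/ideal_gen_ind => [||a _ [u [v [Iu /IHd Qv ->]]]]; [exact: Q0|exact: QD|].
apply: (QC); elim/ideal_gen_ind: Iu => [|y z Qy Qz|b _ /GF[i ->]].
- by rewrite mul0r; apply: (Q0).
- by rewrite mulrDl; apply: (QD).
rewrite -mulrA; apply: (QC); case: Qv => r rv [P hP rP].
exists (rees_gen i * r).
  by rewrite rmorphM /= rv -scalerAl -scalerAr scalerA -exprS.
exists ('X_i * P); last by rewrite !rmorphM /= rees_evalXU rP.
by rewrite -add1n dhomogM // dhomogX; apply/eqP/mdeg1.
Qed.

Lemma fiber_eval_surj (x : special_fiber I) :
  exists P, x = fiber_pi (rees_eval P).
Proof.
have [r ->] : exists r : rees I, x = fiber_pi r.
  by exists (repr x); rewrite /fiber_pi reprK.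
have rX d : exists2 s : rees I, val s = (val r)`_d *: 'X^d &
    exists P, fiber_pi s = fiber_pi (rees_eval P).
  have /fiber_pi_component[s sd [P _ sP]] : ideal_exp I d (val r)`_d.
    by case: (r) => a /= /rees_predP.
  by exists s => //; exists P.
(* Each truncation of [r] lies in the Rees algebra again, so [r] is rebuilt one degree in [t] at a
   time. *)
suff: forall m, exists2 s : rees I, val s = \sum_(i < m) (val r)`_i *: 'X^i &
    exists P, fiber_pi s = fiber_pi (rees_eval P).
  move=> /(_ (size (val r)))[s].
  rewrite -[RHS]poly_def coefK => /val_inj -> [P ->].
  by exists P.
elim=> [|m [s sE [P sP]]].
  by exists 0; [rewrite big_ord0|exists 0; rewrite !rmorph0].
have [s' s'E [P' sP']] := rX m; exists (s + s').
  by rewrite big_ord_recr /= -sE -s'E.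
by exists (P + P'); rewrite !rmorphD /= sP sP'.
Qed.

Lemma fiber_degreeP d (x : special_fiber I) :
  fiber_degree I d x <-> exists2 P, P \is d.-homog & x = fiber_pi (rees_eval P).
Proof.
split=> [[r [f rf] ->]|[P hP ->]].
  have /fiber_pi_component[s sf [P hP sP]] : ideal_exp I d f.
    case: r rf => r /= /rees_predP /(_ d) + rf.
    by rewrite rf coefZ coefXn eqxx mulr1.
  exists P => //; rewrite -sP; congr fiber_pi; apply: val_inj.
  exact: etrans rf (esym sf).
by exists (rees_eval P) => //; have := form_eval_dhomog hP; rewrite -rees_evalE.
Qed.

Definition fiber_eval : {mpoly k[N]} -> special_fiber I :=
  @fiber_pi k n I \o rees_eval.

HB.instance Definition _ := GRing.RMorphism.on fiber_eval.

Fact fiber_eval_is_scalable : scalable fiber_eval.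
Proof.
by move=> c P; rewrite -mul_mpolyC rmorphM /= /fiber_eval /= rees_evalC.
Qed.

HB.instance Definition _ := GRing.isScalable.Build k {mpoly k[N]}
  (special_fiber I) *:%R fiber_eval fiber_eval_is_scalable.

End Presentation.

(** * Algebras presented with the same relations are isomorphic *)

Section Isomorphism.
Import GRing.Theory.
Local Open Scope ring_scope.

(** The isomorphism sends [x] to the image under [b] of a chosen preimage of [x] under [a]; equality
    of kernels makes the choice immaterial. *)
Lemma alg_iso_of_presentations (k : nzRingType) (R A B : algType k)
    (a : {lrmorphism R -> A}) (b : {lrmorphism R -> B}) :
    (forall x, exists p, x = a p) -> (forall y, exists p, y = b p) ->
    (forall p, a p = 0 <-> b p = 0) ->
  exists phi : {lrmorphism A -> B}, bijective phi /\ forall p, phi (a p) = b p.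
Proof.
move=> a_surj b_surj ab_ker.
have ab p q : a p = a q <-> b p = b q.
  by split=> /eqP; rewrite -subr_eq0 -rmorphB => /eqP/ab_ker/eqP;
    rewrite rmorphB subr_eq0 => /eqP.
pose s x := sval (cid (a_surj x)); pose t y := sval (cid (b_surj y)).
have sK x : a (s x) = x by rewrite /s; case: cid.
have tK y : b (t y) = y by rewrite /t; case: cid.
pose f x := b (s x).
have fa p : f (a p) = b p by apply/ab; rewrite sK.
have fB : zmod_morphism f.
  by move=> x y; rewrite -(sK x) -(sK y) -rmorphB !fa rmorphB.
have fM : monoid_morphism f.
  split=> [|x y]; first by rewrite -(rmorph1 a) fa rmorph1.
  by rewrite -(sK x) -(sK y) -rmorphM !fa rmorphM.
have fZ : scalable f by move=> c x; rewrite -(sK x) -linearZ !fa linearZ.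
pose phi : {lrmorphism A -> B} := HB.pack f
  (GRing.isZmodMorphism.Build A B f fB)
  (GRing.isMonoidMorphism.Build A B f fM)
  (GRing.isScalable.Build k A B *:%R f fZ).
exists phi; split=> //; exists (a \o t) => [x|y] /=; last by rewrite fa.
by rewrite -[RHS]sK; apply/ab; rewrite tK.
Qed.

(** The gradings match even if [e1] and [e2] differ, since both degree [d] components are images of
    the same forms of degree [d] in the [T_i]. *)
Lemma special_fibers_isomorphic (k : fieldType) (n1 n2 N e1 e2 : nat)
    (G1 : {mpoly k[n1]} -> Prop) (G2 : {mpoly k[n2]} -> Prop)
    (F1 : 'I_N -> {mpoly k[n1]}) (F2 : 'I_N -> {mpoly k[n2]}) :
    (forall x, G1 x <-> exists i, x = F1 i) ->
    (forall x, G2 x <-> exists i, x = F2 i) ->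
    (forall i, F1 i \is e1.-homog) -> (forall i, F2 i \is e2.-homog) ->
    (forall P, form_eval F1 P = 0 <-> form_eval F2 P = 0) ->
  graded_alg_isomorphic (fiber_degree (ideal_gen G1))
                        (fiber_degree (ideal_gen G2)).
Proof.
move=> GF1 GF2 homF1 homF2 F12.
have [|||phi [phi_bij phiE]] :=
  @alg_iso_of_presentations _ _ _ _ (fiber_eval GF1) (fiber_eval GF2).
- exact: fiber_eval_surj.
- exact: fiber_eval_surj.
- move=> P; split=> [/(fiber_pi_eval_eq0 GF1 homF1)/F12|].
    by move/(fiber_pi_eval_eq0 GF2 homF2).
  by move=> /(fiber_pi_eval_eq0 GF2 homF2)/F12/(fiber_pi_eval_eq0 GF1 homF1).
exists phi; split=> // d x; split=> [/(fiber_degreeP GF1)[P hP ->]|].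
  by apply/(fiber_degreeP GF2); exists P => //; apply: phiE.
move=> /(fiber_degreeP GF2)[P hP xE]; apply/(fiber_degreeP GF1); exists P => //.
by apply: (bij_inj phi_bij); rewrite xE; apply/esym/phiE.
Qed.

End Isomorphism.

(** * Transport of relations along a substitution, up to a common factor *)

Section Specialization.
Import GRing.Theory.
Local Open Scope ring_scope.

(* On F1 apply th and t |-> a t; on F2 apply the injection t |-> b t. *)
Lemma mmap_polyX_specialize (N : nat) (K R1 : comNzRingType) (R2 : idomainType)
    (c1 : K -> R1) (c2 : K -> R2) (F1 : 'I_N -> R1) (F2 : 'I_N -> R2)
    (th : {rmorphism R1 -> R2}) (a b : R2) (P : {mpoly K[N]}) :
    (forall c, th (c1 c) = c2 c) -> (forall i, a * th (F1 i) = b * F2 i) ->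
    b != 0 ->
  mmap (polyC \o c1) (fun i => F1 i *: 'X) P = 0 ->
  mmap (polyC \o c2) (fun i => F2 i *: 'X) P = 0.
Proof.
move=> thC abF b0 P0.
pose u : {rmorphism {poly R1} -> {poly R2}} :=
  comp_poly (a%:P * 'X) \o map_poly th.
pose v : {rmorphism {poly R2} -> {poly R2}} := comp_poly (b%:P * 'X).
have uC c : u (c1 c)%:P = v (c2 c)%:P.
  by rewrite /u /v /= map_polyC /= thC !comp_polyC.
have uX i : u (F1 i *: 'X) = v (F2 i *: 'X).
  rewrite /u /v /= map_polyZ map_polyX /= !comp_polyZ !comp_polyX -!mul_polyC.
  by rewrite !mulrA -!polyCM mulrC [th _ * a]mulrC abF [b * _]mulrC mulrC.
(* As [b != 0], the polynomial [b t] has size 2, and composing with it is injective over a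
   domain. *)
apply/eqP; rewrite -(@comp_poly2_eq0 _ _ (b%:P * 'X)); last first.
  by rewrite size_Cmul // size_polyX.
rewrite -[_ \Po _]/(v _) -(rmorph0 u) -P0 !rmorph_mmap.
by apply/eqP/eq_mmap => [c|i]; apply/esym; [apply: uC|apply: uX].
Qed.

End Specialization.

(** * Maximal minors as a finite family of forms *)

Section MinorsIdeal.
Import GRing.Theory.
Local Open Scope ring_scope.

(** Strict growth gives [i <= f i] by induction from the bottom and [f i <= i] by induction from the
    top. *)
Lemma ord_homo_id n (f : 'I_n -> 'I_n) :
  {homo f : i j / (i < j)%N} -> f =1 id.
Proof.
move=> fh; have fge m (i : 'I_n) : i = m :> nat -> (m <= f i)%N.
  elim: m i => // m IHm i im; have lt_mn : (m < n)%N by have := ltn_ord i; lia.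
  have /fh : (Ordinal lt_mn < i)%N by rewrite im.
  by have := IHm (Ordinal lt_mn) erefl; lia.
have fle m (i : 'I_n) : (i + m).+1 = n -> (f i + m < n)%N.
  elim: m i => [|m IHm] i im; first by rewrite addn0.
  have lt_in : (i.+1 < n)%N by lia.
  have /fh : (i < Ordinal lt_in)%N by [].
  by have := IHm (Ordinal lt_in); rewrite /=; lia.
move=> i; apply: val_inj => /=; have := fge i i erefl.
by have := fle (n - i.+1)%N i; have := ltn_ord i; lia.
Qed.

Lemma dhomog_det (k : comNzRingType) n p (A : 'M[{mpoly k[n]}]_p) :
  (forall i j, A i j \is 1.-homog) -> \det A \is p.-homog.
Proof.
move=> A1; rewrite /determinant; apply: rpred_sum => s _.
suff homP q (F : 'I_q -> {mpoly k[n]}) :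
    (forall i, F i \is 1.-homog) -> \prod_i F i \is q.-homog.
  rewrite -signr_odd; case: odd.
    by rewrite expr1 mulN1r rpredN homP.
  by rewrite expr0 mul1r homP.
elim: q F => [|q IHq] F F1; first by rewrite big_ord0 dhomog1.
by rewrite big_ord_recl; apply: (dhomogM (d := 1)) => //; apply: IHq.
Qed.

Variables (p q : nat).

(* A strictly increasing map 'I_p -> 'I_p is the identity, so the rows of a
   maximal minor involve no choice. *)
Definition column_choice := {g : {ffun 'I_p -> 'I_q} |
  [forall i : 'I_p, forall j : 'I_p, (i < j)%N ==> (g i < g j)%N]}.

Definition maximal_minor (R : comNzRingType) (A : 'M[R]_(p, q))
    (i : 'I_#|{: column_choice}|) : R :=
  \det (colsub (val (enum_val i)) A).

Lemma maximal_minorsP (R : comNzRingType) (A : 'M[R]_(p, q)) (x : R) :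
  (exists (f : 'I_p -> 'I_p) (g : 'I_p -> 'I_q),
    [/\ {homo f : i j / (i < j)%N}, {homo g : i j / (i < j)%N}
      & x = \det (mxsub f g A)]) <->
  exists i, x = maximal_minor A i.
Proof.
split=> [[f [g [/ord_homo_id fE gh ->]]]|[i ->]]; last first.
  exists id, (val (enum_val i)); split=> // u v uv.
  by have /forallP/(_ u)/forallP/(_ v)/implyP := valP (enum_val i); apply.
have gP : [forall i : 'I_p, forall j : 'I_p,
    (i < j)%N ==> ([ffun x => g x] i < [ffun x => g x] j)%N].
  apply/forallP => i; apply/forallP => j; apply/implyP.
  by rewrite !ffunE; apply: gh.
exists (enum_rank (exist _ [ffun x => g x] gP : column_choice)).
rewrite /maximal_minor enum_rankK /=; congr (\det _).
by apply/matrixP => u v; rewrite !mxE fE ffunE.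
Qed.

Lemma map_maximal_minor (R S : comNzRingType) (f : {rmorphism R -> S})
    (A : 'M[R]_(p, q)) i :
  f (maximal_minor A i) = maximal_minor (map_mx f A) i.
Proof. by rewrite /maximal_minor -det_map_mx map_mxsub. Qed.

Lemma maximal_minor_mulmx (R : comNzRingType) (A : 'M[R]_p) (B : 'M_(p, q)) i :
  maximal_minor (A *m B) i = \det A * maximal_minor B i.
Proof. by rewrite /maximal_minor -mulmx_colsub det_mulmx. Qed.

Lemma maximal_minorZ (R : comNzRingType) (a : R) (A : 'M_(p, q)) i :
  maximal_minor (a *: A) i = a ^+ p * maximal_minor A i.
Proof. by rewrite -mul_scalar_mx maximal_minor_mulmx det_scalar. Qed.

End MinorsIdeal.

(** * A Hankel matrix with the same kernel as a given matrix *)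

Section HankelLift.
Import GRing.Theory.
Local Open Scope ring_scope.

Definition hankel (R : Type) (p q : nat) (x : 'I_(p + q).-1 -> R) :
    'M[R]_(p, q) := \matrix_(i, j) x (Ordinal (hankel_subproof i j)).

Variable p : nat.
Local Notation N := (p + p.+2).-1.

Definition middle (j : 'I_p) : 'I_p.+2 := lift ord0 (lift ord_max j).

Lemma middleE j : middle j = j.+1 :> nat.
Proof. by rewrite /middle lift0 /= /bump leqNgt ltn_ord. Qed.

Lemma eq_middle l j : (l == middle j) = (l == j.+1 :> nat).
Proof. by rewrite -(middleE j). Qed.

Variant middle_spec : 'I_p.+2 -> Type :=
  | MiddleFirst : middle_spec ord0
  | MiddleMid j : middle_spec (middle j)
  | MiddleLast : middle_spec ord_max.

Lemma middleP l : middle_spec l.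
Proof.
case: (unliftP ord0 l) => [l' ->|->]; last exact: MiddleFirst.
case: (unliftP ord_max l') => [j ->|->]; first exact: MiddleMid.
by rewrite (_ : lift _ _ = ord_max); [exact: MiddleLast|exact: val_inj].
Qed.

Fact center_subproof : (p < N)%N. Proof. lia. Qed.
Definition center : 'I_N := Ordinal center_subproof.

Section Ring.
Variable R : comNzRingType.
Implicit Type Y : 'M[R]_(p, p.+2).

Definition mid_mx Y : 'M[R]_p := colsub middle Y.

(* For c = 0 or p + 1 this is a kernel vector of Y, supported on c and the
   middle columns; for the middle columns it vanishes. *)
Definition syzygy Y (c : 'I_p.+2) : 'I_p.+2 -> R := fun l =>
  \det (mid_mx Y) *+ (l == c)
  - \sum_j (\adj (mid_mx Y) *m Y) j c *+ (l == middle j).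

(* With g_0 and g_max the polynomials of the syzygies ord0 and ord_max, the rows
   are the coefficients of g_0 t^i and g_max t^i for i < p, separated by the
   central row of the identity matrix. *)
Definition sylvester Y : 'M[R]_N := \matrix_(r, s)
  if (r < p)%N then \sum_l syzygy Y ord0 l *+ (s == r + l :> nat)%N
  else if (r == p :> nat)%N then (s == center)%:R
  else \sum_l syzygy Y ord_max l *+ (s == (r - p.+1) + l :> nat)%N.

(** Cofactors along the central row: a division-free solution of the [2 p] equations given by the
    other rows, hence compatible with ring morphisms. *)
Definition hankel_lift Y (s : 'I_N) : R := \adj (sylvester Y) s center.

Local Notation H Y := (hankel (hankel_lift Y)).

Lemma sylvester_hankel_lift Y r : r != center ->
  \sum_s sylvester Y r s * hankel_lift Y s = 0.
Proof.
move=> rc; have /matrixP/(_ r center) := mul_mx_adj (sylvester Y).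
by rewrite !mxE (negPf rc).
Qed.

(** Pairing [x] with the coefficients of [g t^i] is row [i] of the Hankel matrix applied to [g]. *)
Lemma shift_sum (g : 'I_p.+2 -> R) (x : 'I_N -> R) (i : 'I_p) :
  \sum_(s < N) (\sum_l g l *+ (s == i + l :> nat)%N) * x s =
  \sum_l hankel x i l * g l.
Proof.
under eq_bigr do rewrite mulr_suml.
rewrite exchange_big; apply: eq_bigr => l _ /=; rewrite mxE.
rewrite (bigD1 (Ordinal (hankel_subproof i l))) //= eqxx mulr1n mulrC.
rewrite big1 ?addr0 // => s /eqP sl.
by case: eqP => [sE|]; rewrite ?mul0r //; case: sl; apply: val_inj.
Qed.

Lemma adj_mid_mx Y j l :
  (\adj (mid_mx Y) *m Y) j (middle l) = \det (mid_mx Y) *+ (j == l).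
Proof.
transitivity ((\adj (mid_mx Y) *m mid_mx Y) j l); last by rewrite mul_adj_mx mxE.
by rewrite !mxE; apply: eq_bigr => i _; rewrite !mxE.
Qed.

Lemma syzygy_middle Y j l : syzygy Y (middle j) l = 0.
Proof.
apply/eqP; rewrite subr_eq0 (bigD1 j) //= adj_mid_mx eqxx big1 ?addr0 // => i ij.
by rewrite adj_mid_mx (negPf ij) mul0rn.
Qed.

Lemma hankel_lift_syzygy Y i c : \sum_l H Y i l * syzygy Y c l = 0.
Proof.
case: (middleP c) => [|j|].
- have ip : (i < N)%N by have := ltn_ord i; lia.
  rewrite -shift_sum -[RHS](@sylvester_hankel_lift Y (Ordinal ip)).
    by apply: eq_bigr => s _; rewrite mxE /= ltn_ord.
  by apply/eqP => /(congr1 val) /=; have := ltn_ord i; lia.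
- by apply: big1 => l _; rewrite syzygy_middle mulr0.
(* The row of [g_max t^i] comes after [p] rows for [g_0] and the central row. *)
- have ip : (i + p.+1 < N)%N by have := ltn_ord i; lia.
  rewrite -shift_sum -[RHS](@sylvester_hankel_lift Y (Ordinal ip)).
    apply: eq_bigr => s _; rewrite mxE /= addnK.
    rewrite ifF; last by lia.
    by rewrite ifF //; lia.
  by apply/eqP => /(congr1 val) /=; lia.
Qed.

(** Column [c] of this identity is the orthogonality of the rows of [H Y] to [syzygy Y c], written
    out. *)
Lemma hankel_lift_factor Y :
  \det (mid_mx Y) *: H Y = mid_mx (H Y) *m \adj (mid_mx Y) *m Y.
Proof.
apply/matrixP => i c; rewrite -mulmxA [LHS]mxE [RHS]mxE.
apply/eqP; rewrite -subr_eq0; apply/eqP; rewrite -[RHS](hankel_lift_syzygy Y i c).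
rewrite /syzygy; under [RHS]eq_bigr => l _ do rewrite mulrBr.
rewrite sumrB; congr (_ - _).
  rewrite (bigD1 c) //= eqxx big1 ?addr0 1?mulrC // => l /negPf ->.
  by rewrite mulr0.
under [RHS]eq_bigr => l _ do rewrite mulr_sumr.
rewrite [RHS]exchange_big; apply: eq_bigr => j _ /=.
rewrite (bigD1 (middle j)) //= eqxx big1 ?addr0 ?[mid_mx _ _ _]mxE //.
by move=> l /negPf ->; rewrite mulr0.
Qed.

End Ring.

Lemma map_hankel_lift (R S : comNzRingType) (f : {rmorphism R -> S})
    (Y : 'M[R]_(p, p.+2)) s :
  f (hankel_lift Y s) = hankel_lift (map_mx f Y) s.
Proof.
have midE : mid_mx (map_mx f Y) = map_mx f (mid_mx Y) by rewrite /mid_mx map_mxsub.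
have syzE c l : f (syzygy Y c l) = syzygy (map_mx f Y) c l.
  rewrite /syzygy midE det_map_mx -map_mx_adj -map_mxM rmorphB rmorphMn rmorph_sum.
  by congr (_ - _); apply: eq_bigr => j _; rewrite rmorphMn [in RHS]mxE.
suff sylE : sylvester (map_mx f Y) = map_mx f (sylvester Y).
  by rewrite /hankel_lift sylE -map_mx_adj [RHS]mxE.
apply/matrixP => r u; rewrite !mxE; case: ifP => _; last case: ifP => _.
- by rewrite rmorph_sum; apply: eq_bigr => l _; rewrite rmorphMn syzE.
- by rewrite rmorph_nat.
- by rewrite rmorph_sum; apply: eq_bigr => l _; rewrite rmorphMn syzE.
Qed.

Lemma map_hankel (R S : Type) (f : R -> S) q (x : 'I_(p + q).-1 -> R) :
  map_mx f (hankel x) = hankel (f \o x).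
Proof. by apply/matrixP => i j; rewrite !mxE. Qed.

(** * Nonvanishing at one explicit matrix *)

Section BasePoint.
Variable k : fieldType.

(* Here the syzygies are 1 and t^(p+1), so the Sylvester matrix is the identity. *)
Definition base_mx : 'M[k]_(p, p.+2) := \matrix_(i, j) (j == middle i)%:R.

Lemma mid_base_mx : mid_mx base_mx = 1%:M.
Proof.
apply/matrixP => i j; rewrite !mxE; congr (_%:R).
by rewrite eq_middle middleE eqSS eq_sym.
Qed.

Lemma syzygy_base_mx c l :
  (forall j, c != middle j) -> syzygy base_mx c l = (l == c)%:R.
Proof.
move=> cm; rewrite /syzygy mid_base_mx det1 adj1 mul1mx big1 ?subr0 // => j _.
by rewrite mxE (negPf (cm j)) mul0rn.
Qed.

Lemma sylvester_base_mx : sylvester base_mx = 1%:M.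
Proof.
have c0 j : ord0 != middle j by rewrite eq_middle.
have cmax j : ord_max != middle j.
  by rewrite eq_middle /=; have := ltn_ord j; lia.
have pick (c : 'I_p.+2) (P : 'I_p.+2 -> bool) :
    \sum_l (l == c)%:R *+ P l = (P c)%:R :> k.
  rewrite (bigD1 c) //= eqxx big1 ?addr0 // => l /negPf ->.
  by rewrite mul0rn.
apply/matrixP => r s; rewrite !mxE -!val_eqE /=.
case: ifP => rp; last case: ifP => [/eqP rp'|rp'].
- under eq_bigr => l _ do rewrite syzygy_base_mx //.
  by rewrite pick addn0 eq_sym.
- by rewrite rp' eq_sym.
- under eq_bigr => l _ do rewrite syzygy_base_mx //.
  have pr : (p < r)%N by lia.
  by rewrite pick /= subnK // eq_sym.
Qed.

Lemma hankel_lift_base_mx s : hankel_lift base_mx s = (s == center)%:R.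
Proof. by rewrite /hankel_lift sylvester_base_mx adj1 mxE. Qed.

(** Entry [(i, j)] of the middle block is [x_(i + j + 1)], which is 1 exactly when [i + j + 1 = p]:
    the matrix of the order-reversing permutation. *)
Lemma det_mid_hankel_lift_base_mx :
  \det (mid_mx (hankel (hankel_lift base_mx))) != 0.
Proof.
rewrite (_ : mid_mx _ = perm_mx (perm (@rev_ord_inj p))).
  by rewrite det_perm signr_eq0.
apply/matrixP => i j; rewrite !mxE hankel_lift_base_mx permE; congr (_%:R).
by rewrite -!val_eqE; have := middleE j; have := ltn_ord i => /= ? ->; lia.
Qed.

End BasePoint.
End HankelLift.

(** * Equality of the relations among generic and Hankel minors *)

Section HankelSpecialization.
Import GRing.Theory.
Local Open Scope ring_scope.

Variables (k : fieldType) (p : nat).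
Local Notation Y := (generic_mx k p p.+2).
Local Notation H := (hankel_mx k p p.+2).

Lemma generic_mx_homog i : maximal_minor Y i \is p.-homog.
Proof.
by apply: dhomog_det => u v; rewrite !mxE dhomogX; apply/eqP/mdeg1.
Qed.

Lemma hankel_mx_homog i : maximal_minor H i \is p.-homog.
Proof.
by apply: dhomog_det => u v; rewrite !mxE dhomogX; apply/eqP/mdeg1.
Qed.

Lemma form_eval_generic_hankel P :
  form_eval (maximal_minor Y) P = 0 -> form_eval (maximal_minor H) P = 0.
Proof.
pose th : {rmorphism {mpoly k[p * p.+2]} -> {mpoly k[(p + p.+2).-1]}} :=
  mmap (@mpolyC _ k) (fun u => mxvec H 0 u).
apply: (@mmap_polyX_specialize _ _ _ _ _ _ _ _ th 1 1); last exact: oner_neq0.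
  by move=> c; apply: mmapC.
move=> i; rewrite !mul1r map_maximal_minor; congr (maximal_minor _ i).
by apply/matrixP => u v; rewrite mxE [Y u v]mxE /th /= mmapX mmap1U mxvecE.
Qed.

(** Evaluating the generic entries at [base_mx] turns the second factor into 1 and the first into
    the determinant of a permutation matrix. *)
Lemma det_mid_hankel_lift_neq0 :
  \det (mid_mx (hankel (hankel_lift Y))) * \det (\adj (mid_mx Y)) != 0.
Proof.
pose th : {rmorphism {mpoly k[p * p.+2]} -> k} :=
  meval (fun u => mxvec (base_mx p k) 0 u).
have thY : map_mx th Y = base_mx p k.
  apply/matrixP => u v.
  by rewrite mxE [Y u v]mxE /th /= mevalXU mxvecE.
have mid_map A : map_mx th (mid_mx A) = mid_mx (map_mx th A).
  by rewrite /mid_mx map_mxsub.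
suff : th (\det (mid_mx (hankel (hankel_lift Y))) * \det (\adj (mid_mx Y))) != 0.
  by apply: contraNneq => ->; rewrite rmorph0.
rewrite rmorphM -!det_map_mx map_mx_adj !mid_map thY mid_base_mx adj1 det1 mulr1.
rewrite map_hankel (_ : hankel _ = hankel (hankel_lift (base_mx p k))).
  exact: det_mid_hankel_lift_base_mx.
by apply/matrixP => i j; rewrite !mxE /= map_hankel_lift thY.
Qed.

(** Substitute [hankel_lift Y] for the Hankel variables. Minors of [hankel_lift_factor] show that
    [\det (mid_mx Y) ^+ p] times a substituted minor is the factor of [det_mid_hankel_lift_neq0]
    times the same minor of [Y]. *)
Lemma form_eval_hankel_generic P :
  form_eval (maximal_minor H) P = 0 -> form_eval (maximal_minor Y) P = 0.
Proof.
pose th : {rmorphism {mpoly k[(p + p.+2).-1]} -> {mpoly k[p * p.+2]}} :=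
  mmap (@mpolyC _ k) (hankel_lift Y).
apply: (@mmap_polyX_specialize _ _ _ _ _ _ _ _ th (\det (mid_mx Y) ^+ p) _ _ _ _
  det_mid_hankel_lift_neq0).
  by move=> c; apply: mmapC.
move=> i; rewrite map_maximal_minor (_ : map_mx th H = hankel (hankel_lift Y)).
  rewrite -maximal_minorZ hankel_lift_factor -mulmxA.
  by rewrite !maximal_minor_mulmx mulrA.
by apply/matrixP => u v; rewrite !mxE /th /= mmapX mmap1U.
Qed.

End HankelSpecialization.

Theorem proposition4p1 (k : fieldType) (m : nat)
    (char0 : [pchar k]%R =i pred0) (m_ge2 : (2 <= m)%N) :
  graded_alg_isomorphic
    (fiber_degree (minors_ideal m.-1 (generic_mx k m.-1 m.+1)))
    (fiber_degree (minors_ideal m.-1 (hankel_mx k m.-1 m.+1))).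
Proof.
(* With [m = p.+1] both matrices have [p] rows and [p.+2] columns. *)
case: m m_ge2 => // p _.
apply: (special_fibers_isomorphic (maximal_minorsP _) (maximal_minorsP _)
  (@generic_mx_homog k p) (@hankel_mx_homog k p)) => P.
by split; [apply: form_eval_generic_hankel|apply: form_eval_hankel_generic].
Qed.
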